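(* If the Riordan graph $G=G_n(g,tg)$ is io-decomposable, then the number $m(G)$ of edges of $G$ is $$m(G)=2\,m\left(G_{\lceil n/2\rceil}\right)+m\left(H_{\lfloor n/2\rfloor+1}\right),$$ where $G_{\lceil n/2\rceil}=G_{\lceil n/2\rceil}(g,tg)$ and $H_{\lfloor n/2\rfloor+1}\cong G_{\lfloor n/2\rfloor+1}\left((tg)'(\sqrt t),tg\right)$.
   Context: Power series have coefficients in $\mathbb{Z}$ (or $\mathbb{Z}_2$); $\equiv$ means congruence mod $2$; $[t^k]u$ is the coefficient of $t^k$ in $u$. For $f(0)=0$, the Riordan graph $G_n(g,f)$ is the simple graph on $[n]=\{1,\dots,n\}$ in which, for $i>j\ge1$, $i$ and $j$ are adjacent iff $[t^{i-2}]\,g f^{\,j-1}\equiv 1$. It is proper if $g(0)\equiv f'(0)\equiv1$. $m(\cdot)$ denotes the number of edges. Modulo $2$, $(tg)'$ has only even powers of $t$, and $(tg)'(\sqrt t)$ denotes the mod-$2$ series $\sum_{k\ge0}\left([t^{2k}]g\right)t^k$. A proper Riordan graph $G_n(g,f)$, with odd vertex set $V_o$ and even vertex set $V_e$, is io-decomposable if the induced subgraph $\langle V_o\rangle\cong G_{\lceil n/2\rceil}(g,f)$ via the relabeling $2k-1\mapsto k$ and the induced subgraph $\langle V_e\rangle$ is a null graph (no edges). *)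

(* Defs.v *)
From mathcomp Require Import all_boot all_order all_algebra.

Set Implicit Arguments.
Unset Strict Implicit.
Unset Printing Implicit Defensive.

Import Order.TTheory GRing.Theory Num.Theory.

Local Open Scope ring_scope.

(* A formal power series over Z is its coefficient sequence: [t^k]u is [u k]. *)
Definition series := nat -> int.

Definition sone : series := fun k => (k == 0%N)%:R.

Definition sX : series := fun k => (k == 1%N)%:R.

Definition smul (u v : series) : series :=
  fun k => \sum_(i < k.+1) u i * v (k - i)%N.

Definition sexp (u : series) (j : nat) : series := iter j (smul u) sone.

Definition sderiv (u : series) : series := fun k => u k.+1 *+ k.+1.

(* u(sqrt t), meant for a series u with only even powers of t modulo 2. *)
Definition ssqrt (u : series) : series := fun k => u k.*2.

Record sgraph := SGraph {
  vertex :> finType;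
  edge : rel vertex;
  edge_sym : symmetric edge;
  edge_irr : irreflexive edge }.

Arguments edge {s}.

Definition edge_set (G : sgraph) : {set {set G}} :=
  [set [set x; y] | x in G, y in G & edge x y].

Definition num_edges (G : sgraph) : nat := #|edge_set G|.

Definition is_iso (G H : sgraph) (h : G -> H) : Prop :=
  bijective h /\ forall x y, edge (h x) (h y) = edge x y.

Definition isomorphic (G H : sgraph) : Prop := exists h : G -> H, is_iso h.

Definition null_graph (G : sgraph) : Prop := forall x y : G, ~~ edge x y.

Definition induced_edge (G : sgraph) (A : {set G}) : rel {x : G | x \in A} :=
  fun x y => edge (val x) (val y).

Fact induced_edge_sym (G : sgraph) (A : {set G}) : symmetric (@induced_edge G A).
Proof. by move=> x y; apply: edge_sym. Qed.

Fact induced_edge_irr (G : sgraph) (A : {set G}) :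
  irreflexive (@induced_edge G A).
Proof. by move=> x; apply: edge_irr. Qed.

Definition induced (G : sgraph) (A : {set G}) : sgraph :=
  SGraph (@induced_edge_sym G A) (@induced_edge_irr G A).

(* The condition [t^(i-2)] g f^(j-1) = 1 mod 2, for labels i > j >= 1. *)
Definition riordan_entry (g f : series) (i j : nat) : bool :=
  (smul g (sexp f j.-1) (i - 2)%N == 1 %[mod 2])%Z.

(* The element v : 'I_n stands for the vertex of [n] with label v.+1. *)
Definition label (n : nat) (v : 'I_n) : nat := v.+1.

Definition riordan_edge (n : nat) (g f : series) : rel 'I_n := fun v w =>
  ((label w < label v)%N && riordan_entry g f (label v) (label w))
  || ((label v < label w)%N && riordan_entry g f (label w) (label v)).

Fact riordan_edge_sym (n : nat) (g f : series) :
  symmetric (@riordan_edge n g f).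
Proof. by move=> v w; rewrite /riordan_edge orbC. Qed.

Fact riordan_edge_irr (n : nat) (g f : series) :
  irreflexive (@riordan_edge n g f).
Proof. by move=> v; rewrite /riordan_edge ltnn. Qed.

(* G_n(g, f); the definition is only meaningful when f(0) = 0. *)
Definition riordan_graph (n : nat) (g f : series) : sgraph :=
  SGraph (@riordan_edge_sym n g f) (@riordan_edge_irr n g f).

Definition odd_vertices (n : nat) (g f : series) : {set riordan_graph n g f} :=
  [set v : 'I_n | odd (label v)].

Definition even_vertices (n : nat) (g f : series) : {set riordan_graph n g f} :=
  [set v : 'I_n | ~~ odd (label v)].

Definition proper_riordan (g f : series) : Prop :=
  [/\ f 0%N = 0, (g 0%N = 1 %[mod 2])%Z & (sderiv f 0%N = 1 %[mod 2])%Z].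

Fact half_ltn_uphalf (n : nat) (v : 'I_n) : (v./2 < uphalf n)%N.
Proof.
by case: n v => [[]//|n] v; rewrite /= ltnS; apply: half_leq; rewrite -ltnS.
Qed.

(* 2k-1 |-> k on labels, that is 2k-2 |-> k-1 on underlying ordinals;
   uphalf n is the ceiling of n/2. *)
Definition odd_relabel (n : nat) (g f : series)
    (v : induced (odd_vertices n g f)) : riordan_graph (uphalf n) g f :=
  Ordinal (half_ltn_uphalf (val v)).

Definition io_decomposable (n : nat) (g f : series) : Prop :=
  [/\ proper_riordan g f,
      is_iso (@odd_relabel n g f)
    & null_graph (induced (even_vertices n g f))].

Lemma smulXE (u : series) (k : nat) :
  smul sX u k = if k is k'.+1 then u k' else 0.
Proof.
rewrite /smul /sX; case: k => [|k]; first by rewrite big_ord1 mul0r.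
rewrite !big_ord_recl /= mul0r add0r mul1r big1 ?addr0 ?subn1 //.
by move=> i _; rewrite mul0r.
Qed.

Lemma dvdz2_double (c : int) (k : nat) : (2 %| c *+ k.*2)%Z.
Proof. by rewrite -mul2n mulrnA -[c *+ 2]mulr_natr -mulrnAl dvdz_mull. Qed.

(* Modulo 2, (tg)' has only even powers of t, and (tg)'(sqrt t) is the series
   with coefficients [t^(2k)]g. *)
Lemma sderivX_odd (g : series) (k : nat) :
  (sderiv (smul sX g) k.*2.+1 = 0 %[mod 2])%Z.
Proof.
by apply/eqP; rewrite /sderiv smulXE eqz_mod_dvd subr0 -doubleS dvdz2_double.
Qed.

Lemma ssqrt_sderivX (g : series) (k : nat) :
  (ssqrt (sderiv (smul sX g)) k = g k.*2 %[mod 2])%Z.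
Proof.
apply/eqP; rewrite /ssqrt /sderiv smulXE eqz_mod_dvd mulrS addrAC subrr add0r.
exact: dvdz2_double.
Qed.

(* Main.v *)
Require Import Defs.
From mathcomp Require Import all_boot all_order all_algebra.
From mathcomp Require Import zify.

Set Implicit Arguments.
Unset Strict Implicit.
Unset Printing Implicit Defensive.

Import GRing.Theory.

(** The edges of [G_n(g, tg)] are sorted by the parities of their two labels.
    An edge between two odd labels is an edge of [G_{ceil(n/2)}(g, tg)], and
    there is none between two even labels: this is io-decomposability.  The
    mixed edges are governed by the Frobenius identity [u(t)^2 = u(t^2)] modulo
    2, by which the coefficient of [t^(2k)] in [u^2 v] is the coefficient of
    [t^k] in [u v_0], where [v_0] collects the even coefficients of [v]
    ([coef_sqr_mul]).
    - If the larger label [2a+1] is odd and the smaller one [2b+2] is even, the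
      entry is the coefficient of [t^(2a)] in [(tg)^(2(b+1))], hence that of
      [t^a] in [(tg)^(b+1)], which is the entry of [G(g, tg)] at [(a+1, b+1)]:
      these edges give a second copy of [G_{ceil(n/2)}(g, tg)]
      ([riordan_entry_odd_even]).
    - If the larger label [2a+2] is even and the smaller one [2b+1] is odd, the
      entry is the coefficient of [t^(2a)] in [g (tg)^(2b)], hence that of
      [t^a] in [g_0 (tg)^b], which is the entry of [G((tg)'(sqrt t), tg)] at
      [(a+2, b+1)], because [g_0] is [(tg)'(sqrt t)]
      ([riordan_entry_even_odd]).

    Summing over the lower triangle of the adjacency matrix, row by row,
    gives the formula: the row of an odd label contributes twice a row of the
    half-size graph ([row_weight_odd_label]), and the row of an even label
    contributes a row of the third graph ([row_weight_even_label]). *)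

(** * Series modulo 2 and the Frobenius identity *)

Section ModTwo.

Local Open Scope ring_scope.

(** Entries of a Riordan matrix involve finitely many coefficients, so a
    polynomial over ['F_2] that agrees with a series below some degree can stand
    for it, and products become products in a commutative ring. *)
Definition reduces (N : nat) (u : series) (p : {poly 'F_2}) : Prop :=
  forall k, (k < N)%N -> p`_k = (u k)%:~R.

Lemma reduces_poly N u : reduces N u (\poly_(k < N) (u k)%:~R).
Proof. by move=> k ltkN; rewrite coef_poly ltkN. Qed.

Lemma reduces_one N : reduces N sone 1.
Proof. by move=> k _; rewrite coef1 /sone; case: (k == 0%N). Qed.

Lemma reduces_X N : reduces N sX 'X.
Proof. by move=> k _; rewrite coefX /sX; case: (k == 1%N). Qed.

Lemma reduces_mul N u v p q :
  reduces N u p -> reduces N v q -> reduces N (smul u v) (p * q).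
Proof.
move=> up vq k ltkN; rewrite coefM /smul raddf_sum /=.
apply: eq_bigr => i _; rewrite intrM up ?vq //.
  by apply: leq_ltn_trans ltkN; apply: leq_subr.
by apply: leq_trans ltkN; apply: ltn_ord.
Qed.

Lemma reduces_exp N u p j : reduces N u p -> reduces N (sexp u j) (p ^+ j).
Proof.
move=> up; elim: j => [|j IHj]; first exact: reduces_one.
by rewrite exprS; apply: reduces_mul.
Qed.

Lemma eqz_mod2 (a b : int) : (a == b %[mod 2])%Z = (a%:~R == b%:~R :> 'F_2).
Proof.
by rewrite eqz_mod_dvd (dvdz_pcharf (pchar_Fp (isT : prime 2))) intrB subr_eq0.
Qed.

Lemma reduces_sqrt_deriv N g p :
  reduces N.*2 g p ->
  reduces N (ssqrt (sderiv (smul sX g))) (even_poly p).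
Proof.
move=> gp k ltkN; rewrite coef_even_poly gp ?ltn_double //.
by apply/eqP; rewrite -eqz_mod2 ssqrt_sderivX.
Qed.

Lemma riordan_entry_coef N g f p q i j :
  reduces N g p -> reduces N f q -> (i - 2 < N)%N ->
  riordan_entry g f i j = ((p * q ^+ j.-1)`_(i - 2) == 1).
Proof.
move=> gp fq ltiN; rewrite /riordan_entry eqz_mod2.
by rewrite (reduces_mul gp (reduces_exp j.-1 fq)).
Qed.

Lemma sqr_poly_F2 (p : {poly 'F_2}) : p ^+ 2 = p \Po 'X^2.
Proof.
have F2_2 : 2%:R = 0 :> 'F_2 by apply: pchar_Fp_0.
elim/poly_ind: p => [|p c IHp]; first by rewrite comp_poly0 expr0n.
rewrite sqrrD comp_polyD comp_polyM comp_polyX comp_polyC -IHp exprMn.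
have -> : c%:P ^+ 2 = c%:P.
  by rewrite -rmorphXn; congr polyC; apply/val_inj; case: c => [[|[|]]].
by rewrite -mulr_natl -(rmorph_nat polyC) F2_2 mul0r addr0.
Qed.

(** By [sqr_poly_F2] the factor [q ^+ 2] has only even powers, hence the even
    coefficients of the product involve only those of [r]. *)
Lemma coef_sqr_mul (q r : {poly 'F_2}) k :
  (q ^+ 2 * r)`_k.*2 = (q * even_poly r)`_k.
Proof.
rewrite -[in LHS](poly_even_odd r) mulrDr mulrA sqr_poly_F2 -!comp_polyM coefD.
rewrite coefMX !coef_comp_poly_Xn // dvdn2 odd_double -muln2 mulnK //=.
case: k => [|k]; first by rewrite mul0n eqxx addr0.
by rewrite muln2 doubleS /= dvdn2 /= odd_double /= addr0.
Qed.

Lemma coef_sqr (q : {poly 'F_2}) k : (q ^+ 2)`_k.*2 = q`_k.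
Proof. by rewrite -[q ^+ 2]mulr1 coef_sqr_mul even_polyC mulr1. Qed.

(** Multiplication by [t] turns [g (tg)^j] into [(tg)^(j+1)], so that entries of
    [G(g, tg)] are coefficients of pure powers of [tg], to which Frobenius
    applies directly when the exponent is even. *)
Lemma riordan_entry_X_coef N g p i j :
  reduces N g p -> (i < N)%N ->
  riordan_entry g (smul sX g) i.+2 j.+1 = ((('X * p) ^+ j.+1)`_i.+1 == 1).
Proof.
move=> gp ltiN.
rewrite (riordan_entry_coef _ gp (reduces_mul (@reduces_X N) gp)) ?subn2 //=.
by rewrite [in RHS]exprS -mulrA coefXM.
Qed.

(** The exponent [b.*2.+2] of [tg] is even: Frobenius halves it together with
    the row.  The bound [0 < a] keeps the truncated subtraction [i - 2] of
    [riordan_entry] faithful. *)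
Lemma riordan_entry_odd_even g a b :
  (0 < a)%N ->
  riordan_entry g (smul sX g) a.*2.+1 b.*2.+2
    = riordan_entry g (smul sX g) a.+1 b.+1.
Proof.
case: a => // a _; rewrite doubleS.
have gp := @reduces_poly a.*2.+2 g.
rewrite !(riordan_entry_X_coef _ gp) //; last first.
  by rewrite -addnn !ltnS leqW ?leq_addr.
by rewrite -[b.*2.+2]doubleS -[in b.+1.*2]muln2 exprM -[a.*2.+2]doubleS coef_sqr.
Qed.

(** Here [tg] has the even exponent [b.*2] and is followed by one factor [g], of
    which only the even coefficients survive, that is [(tg)'(sqrt t)]. *)
Lemma riordan_entry_even_odd g a b :
  riordan_entry g (smul sX g) a.*2.+2 b.*2.+1
    = riordan_entry (ssqrt (sderiv (smul sX g))) (smul sX g) a.+2 b.+1.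
Proof.
have gp := @reduces_poly a.+1.*2 g.
have gp' : reduces a.+1 g (\poly_(k < a.+1.*2) (g k)%:~R).
  by move=> k ltka; rewrite gp // -addnn ltn_addr.
have Xp N : reduces N sX 'X by apply: reduces_X.
rewrite (riordan_entry_coef _ gp (reduces_mul (Xp _) gp)) ?subn2 //=.
rewrite (riordan_entry_coef _ (reduces_sqrt_deriv gp)
           (reduces_mul (Xp _) gp')) ?subn2 //=.
by rewrite mulrC -[b.*2]muln2 exprM coef_sqr_mul mulrC.
Qed.

End ModTwo.

(** * Counting edges *)

Lemma isomorphic_num_edges (G H : sgraph) :
  isomorphic G H -> num_edges G = num_edges H.
Proof.
case=> h [bij_h edge_h]; have [h' hK h'K] := bij_h.
rewrite /num_edges -(card_imset (mem (edge_set G)) (imset_inj (can_inj hK))).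
congr #|pred_of_set _|; apply/setP=> e; apply/imsetP/imset2P.
  case=> _ /imset2P[x y _ xy ->] ->; exists (h x) (h y) => //.
    by move: xy; rewrite !inE /= edge_h.
  by rewrite imsetU1 imset_set1.
case=> x y _ xy ->; exists [set h' x; h' y]; last first.
  by rewrite imsetU1 imset_set1 !h'K.
by apply/imset2P; exists (h' x) (h' y); rewrite // !inE /= -edge_h !h'K // in xy *.
Qed.

(** Each edge is counted once, in the row of its larger label.  The row of index
    [i] is that of the label [i.+1], whence the exchange of parities between
    indices and labels. *)
Definition row_weight (g f : series) (i : nat) : nat :=
  \sum_(j < i) riordan_entry g f i.+1 j.+1.

Lemma num_edges_row_weight n g f :
  num_edges (riordan_graph n g f) = \sum_(i < n) row_weight g f i.
Proof.
pose A := [set p : 'I_n * 'I_n | (p.2 < p.1)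
                                 && riordan_entry g f p.1.+1 p.2.+1].
have -> : num_edges (riordan_graph n g f) = #|A|.
  rewrite /num_edges; have -> : edge_set (riordan_graph n g f)
                              = [set [set p.1; p.2] | p in A]; last first.
    apply: card_in_imset => -[x y] [x' y']; rewrite !inE /=.
    move=> /andP[lt_yx _] /andP[lt_yx' _] /setP eq_e.
    have: x \in [set x'; y'] by rewrite -eq_e set21.
    have: y \in [set x'; y'] by rewrite -eq_e set22.
    by rewrite !inE => /orP[]/eqP ey /orP[]/eqP ex; subst x y => //; lia.
  apply/setP=> e; apply/imset2P/imsetP => [[x y _]|[[x y]]].
    rewrite !inE /= /riordan_edge /label !ltnS => /orP[xy|xy] ->.
      by exists (x, y); rewrite // inE.
    by exists (y, x); rewrite /= ?inE // setUC.
  rewrite inE /= => xy ->; exists x y => //.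
  by rewrite !inE /= /riordan_edge /label ltnS xy.
have -> : #|A| = \sum_(i < n) \sum_(j < n) ((i, j) \in A).
  rewrite pair_bigA -sum1_card big_mkcond /=.
  by apply: eq_bigr => -[x y] _ /=; case: (_ \in A).
apply: eq_bigr => i _; rewrite /row_weight.
rewrite (big_ord_widen n (fun j => riordan_entry g f i.+1 j.+1 : nat)); last first.
  exact: ltnW.
rewrite [RHS]big_mkcond; apply: eq_bigr => j _.
by rewrite inE /=; case: (j < i).
Qed.

Lemma sum_even_odd n (F : nat -> nat) :
  \sum_(i < n) F i
    = \sum_(a < uphalf n) F a.*2 + \sum_(a < n./2) F a.*2.+1.
Proof.
elim: n => [|n IHn]; first by rewrite !big_ord0.
rewrite big_ord_recr /= IHn uphalf_half; case: (boolP (odd n)) => odd_n.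
  have -> : F n = F n./2.*2.+1 by rewrite -{1}(odd_double_half n) odd_n.
  by rewrite add1n [X in _ = _ + X]big_ord_recr /= addnA.
have -> : F n = F n./2.*2 by rewrite -{1}(odd_double_half n) (negPf odd_n).
by rewrite add0n [X in _ = X + _]big_ord_recr /= addnAC.
Qed.

(** * Rows of an io-decomposable Riordan graph *)

Lemma io_odd_odd n g f a b :
  io_decomposable n g f -> b < a -> a < uphalf n ->
  riordan_entry g f a.*2.+1 b.*2.+1 = riordan_entry g f a.+1 b.+1.
Proof.
case=> _ [_ iso] _ ltba ltan.
have lt2an : a.*2 < n by lia.
have lt2bn : b.*2 < n by lia.
have odd_a : Ordinal lt2an \in odd_vertices n g f by rewrite inE /= odd_double.
have odd_b : Ordinal lt2bn \in odd_vertices n g f by rewrite inE /= odd_double.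
pose sub v : v \in odd_vertices n g f -> induced (odd_vertices n g f) :=
  exist (fun v => is_true (v \in odd_vertices n g f)) v.
move: (iso (sub _ odd_a) (sub _ odd_b)).
rewrite /= /induced_edge /= /riordan_edge /label /= !doubleK !ltnS !ltn_double.
by rewrite ltba ltnNge ltnW //= !orbF.
Qed.

Lemma io_even_even n g f a b :
  io_decomposable n g f -> b < a -> a < n./2 ->
  riordan_entry g f a.*2.+2 b.*2.+2 = false.
Proof.
case=> _ _ null ltba ltan.
have lt2an : a.*2.+1 < n by lia.
have lt2bn : b.*2.+1 < n by lia.
have even_a : Ordinal lt2an \in even_vertices n g f.
  by rewrite inE /= odd_double.
have even_b : Ordinal lt2bn \in even_vertices n g f.
  by rewrite inE /= odd_double.
pose sub v : v \in even_vertices n g f -> induced (even_vertices n g f) :=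
  exist (fun v => is_true (v \in even_vertices n g f)) v.
move: (null (sub _ even_a) (sub _ even_b)).
rewrite /= /induced_edge /= /riordan_edge /label /= !ltnS ltn_double ltba /=.
by rewrite negb_or => /andP[/negPf].
Qed.

(** Both the odd and the even smaller labels reproduce the row [a] of [G(g, tg)],
    the former by io-decomposability and the latter by Frobenius. *)
Lemma row_weight_odd_label n g a :
  io_decomposable n g (smul sX g) -> a < uphalf n ->
  row_weight g (smul sX g) a.*2 = 2 * row_weight g (smul sX g) a.
Proof.
move=> hio ltan; rewrite {1}/row_weight.
rewrite (sum_even_odd _ (fun j => riordan_entry g (smul sX g) a.*2.+1 j.+1 : nat)).
rewrite uphalf_double doubleK mulSn mul1n; congr (_ + _).
  by apply: eq_bigr => b _; rewrite (io_odd_odd hio).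
apply: eq_bigr => b _; rewrite riordan_entry_odd_even //.
exact: leq_ltn_trans (ltn_ord b).
Qed.

(** There are [a] even smaller labels, none adjacent, and [a.+1] odd ones, as
    many as the entries of the row [a.+1] on the right-hand side. *)
Lemma row_weight_even_label n g a :
  io_decomposable n g (smul sX g) -> a < n./2 ->
  row_weight g (smul sX g) a.*2.+1
    = row_weight (ssqrt (sderiv (smul sX g))) (smul sX g) a.+1.
Proof.
move=> hio ltan; rewrite {1}/row_weight.
rewrite (sum_even_odd _ (fun j => riordan_entry g (smul sX g) a.*2.+2 j.+1 : nat)).
rewrite /= doubleK uphalf_double addnC big1 => [|b _].
  by apply: eq_bigr => b _; rewrite riordan_entry_even_odd.
by rewrite (io_even_even hio).
Qed.

Theorem lemma4p9 (n : nat) (g : series) (H : sgraph)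
  (hio : io_decomposable n g (smul sX g))
  (hH : isomorphic H
          (riordan_graph (n./2).+1 (ssqrt (sderiv (smul sX g))) (smul sX g))) :
  num_edges (riordan_graph n g (smul sX g)) =
    2 * num_edges (riordan_graph (uphalf n) g (smul sX g)) + num_edges H.
Proof.
rewrite (isomorphic_num_edges hH) !num_edges_row_weight sum_even_odd.
congr (_ + _).
  by rewrite big_distrr; apply: eq_bigr => a _; apply: row_weight_odd_label hio _.
(* The first vertex has no smaller neighbour, so the rows of the third graph
   are matched from the second one on. *)
rewrite big_ord_recl [row_weight _ _ ord0]big_ord0 add0n.
by apply: eq_bigr => a _; apply: row_weight_even_label hio _.
Qed.
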